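(* Denote by \[ M_n=\bigl|\{A-A : A\subseteq\{0,\ldots,n\},\ 0,n\in A\}\bigr| \] the number of distinct difference multisets $A-A$ arising from subsets $A\subseteq\{0,\ldots,n\}$ containing both $0$ and $n$. Then \[ M_n=2^{n-2}+O(12^{n/4}). \]
   Context: For a finite set $A$ of integers, $A-A$ denotes the set of differences regarded as a multiset: the multiplicity of an integer $d$ in $A-A$ is the number of pairs $(a,b)\in A\times A$ with $a-b=d$. Here $n\ge 1$ is an integer and the implied constant in $O(\cdot)$ is absolute. *)

(* Defs.v *)
From HB Require Import structures.
From mathcomp Require Import all_boot all_order all_algebra.
From mathcomp Require Import finmap multiset.

Set Implicit Arguments.
Unset Strict Implicit.
Unset Printing Implicit Defensive.

Import Order.TTheory GRing.Theory Num.Theory.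

Local Open Scope fset_scope.
Local Open Scope mset_scope.
Local Open Scope ring_scope.

(* The multiplicity of d in seq_mset s is its number of occurrences in s
   (mset_seqE); enum_fset A is duplicate-free, so each pair (a, b) of A x A
   contributes exactly once. *)
Definition diff_mset (A : {fset int}) : {mset int} :=
  seq_mset [seq a - b | a <- enum_fset A, b <- enum_fset A].

Definition int_upto (n : nat) : {fset int} :=
  [fset i%:Z | i in iota 0 n.+1].

Definition end_subsets (n : nat) : {fset {fset int}} :=
  [fset A in fpowerset (int_upto n) | (0 \in A) && (n%:Z \in A)].

Definition num_diff_msets (n : nat) : nat :=
  #|` [fset diff_mset A | A in end_subsets n] |.

(* Main.v *)
(* The reflection A |-> n - A preserves the difference multiset and fixes only
   O(2^(n/2)) sets, so it suffices to bound the number of A for which some B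
   other than A and n - A has B - B = A - A.

   Identify A and B with 0-1 polynomials of degree n, and write f~ for the
   reversal of f.  Over F_2, A A~ = B B~ together with unique factorization
   gives A = p q and B = p q~, where q <> q~ (as B <> A) and p <> p~ (as
   B <> A~).  Replacing B by B~ exchanges p and q, so we may assume
   d = deg q <= n/2.  Let k be the valuation of t = q - q~; as q agrees with
   q~ below k, there are O(2^(d-k)) such q.

   Fix q and put m = n - d.  Determine p from both ends, choosing
   (p_i, p_(m-i)) for i = 0, 1, ...  The coefficients of E = p t = A - B at
   i+k and n-i-k are p_i and p_(m-i) plus known terms, while those at i and
   n-i are already known.  If the latter are both 0, the four choices are
   allowed; otherwise the multiplicity of n-i in the difference multisets
   (over the integers, not only mod 2) fixes p_i, p_(m-i) or p_i + p_(m-i).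
   Give weight 3 to a pair (E_i, E_(n-i)) equal to (0, 0) and weight 2 to the
   others: four allowed choices have total weight 9 = 3 * 3 and two have at
   most 5 < 3 * 2, so the weighted count grows at most by a factor 3 per step.
   Hence there are at most 2 (3/2)^k 3^((m+1)/2) polynomials p for each q, and
   the sum of 2^(d-k) (3/2)^k 3^((n-d)/2) over d <= n/2 and k is dominated by
   d = n/2, where 2^(n/2) 3^(n/4) = 12^(n/4). *)

Require Import Defs.
From mathcomp Require Import all_boot all_order all_algebra.
From mathcomp Require Import finmap multiset.
From mathcomp Require Import reals exp.
From mathcomp Require Import zify ring lra.

Import Order.TTheory GRing.Theory Num.Theory.

Set Implicit Arguments.
Unset Strict Implicit.
Unset Printing Implicit Defensive.

Local Open Scope ring_scope.

(** * Reversal of polynomials *)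

Section Reversal.
Variable R : comNzRingType.
Implicit Types f g : {poly R}.

(** Reversal at a nominal degree [n] rather than the actual one, which makes it additive. *)
Definition rev_poly n f : {poly R} := \poly_(i < n.+1) f`_(n - i).

Lemma size_rev_poly n f : (size (rev_poly n f) <= n.+1)%N.
Proof. exact: size_poly. Qed.

Lemma coef_rev_poly n f i : (i <= n)%N -> (rev_poly n f)`_i = f`_(n - i).
Proof. by rewrite coef_poly ltnS => ->. Qed.

Lemma rev_polyK n f : (size f <= n.+1)%N -> rev_poly n (rev_poly n f) = f.
Proof.
move=> sf; apply/polyP => i; case: (leqP i n) => [le_in | lt_ni].
  by rewrite !coef_rev_poly ?leq_subr// subKn.
by rewrite !nth_default// (leq_trans _ lt_ni) ?size_rev_poly.
Qed.

Lemma rev_poly_sum n (I : Type) (r : seq I) (F : I -> {poly R}) :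
  rev_poly n (\sum_(i <- r) F i) = \sum_(i <- r) rev_poly n (F i).
Proof.
apply/polyP => i; rewrite coef_sum coef_poly; case: ifP => lt_i.
  by rewrite coef_sum; apply: eq_bigr => j _; rewrite coef_poly lt_i.
by rewrite big1// => j _; rewrite coef_poly lt_i.
Qed.

Lemma rev_polyZXn n c i : (i <= n)%N ->
  rev_poly n (c *: 'X^i) = c *: 'X^(n - i).
Proof.
move=> le_in; apply/polyP => j; rewrite coef_poly !coefZ !coefXn.
case: ltnP => lt_j; first by congr (_ * (nat_of_bool _)%:R); lia.
by rewrite (_ : (j == n - i)%N = false) ?mulr0//; lia.
Qed.

Lemma poly_sumXn n f : (size f <= n)%N -> f = \sum_(i < n) f`_i *: 'X^i.
Proof.
move=> sf; rewrite -poly_def; apply/polyP => i; rewrite coef_poly.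
by case: ltnP => // le_ni; rewrite nth_default// (leq_trans sf).
Qed.

Lemma rev_polyE n f : (size f <= n.+1)%N ->
  rev_poly n f = \sum_(i < n.+1) f`_i *: 'X^(n - i).
Proof.
move=> sf; rewrite {1}(poly_sumXn sf) rev_poly_sum; apply: eq_bigr => i _.
by rewrite rev_polyZXn// -ltnS.
Qed.

Lemma rev_polyM m n f g : (size f <= m.+1)%N -> (size g <= n.+1)%N ->
  rev_poly (m + n) (f * g) = rev_poly m f * rev_poly n g.
Proof.
move=> sf sg; rewrite [in LHS](poly_sumXn sf) [in LHS](poly_sumXn sg).
rewrite mulr_suml rev_poly_sum (rev_polyE sf) (rev_polyE sg) mulr_suml.
apply: eq_bigr => i _; rewrite 2!mulr_sumr rev_poly_sum; apply: eq_bigr => j _.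
have [le_i le_j] : (i <= m)%N /\ (j <= n)%N by split; rewrite -ltnS.
rewrite -!scalerAl -!scalerAr !scalerA -!exprD rev_polyZXn.
  by congr (_ *: 'X^_); lia.
exact: leq_add.
Qed.

(** In the convolution, indices below [i] kill the factor from [f] and indices above [i] kill the
    one from [g]; only [j = i] survives. *)
Lemma coefM_low f g i k :
  (forall j, (j < i)%N -> f`_j = 0) -> (forall j, (j < k)%N -> g`_j = 0) ->
  (f * g)`_(i + k) = f`_i * g`_k.
Proof.
move=> f0 g0; rewrite coefM.
have lt_i : (i < (i + k).+1)%N by rewrite ltnS leq_addr.
rewrite (bigD1 (Ordinal lt_i))//= addKn big1 ?addr0// => -[j lt_j] /eqP ne_j.
have {}ne_j : j != i by apply/eqP => e; apply: ne_j; apply: val_inj.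
case: (ltnP j i) => [/f0 ->|le_ij]/=; first by rewrite mul0r.
by rewrite g0 ?mulr0//; lia.
Qed.

Lemma coefM_low0 f g i k j :
  (forall j, (j < i)%N -> f`_j = 0) -> (forall j, (j < k)%N -> g`_j = 0) ->
  (j < i + k)%N -> (f * g)`_j = 0.
Proof.
move=> f0 g0 lt_j; rewrite coefM big1// => -[l lt_l] _ /=.
case: (ltnP l i) => [/f0 ->|le_il]; first by rewrite mul0r.
by rewrite g0 ?mulr0//; lia.
Qed.

End Reversal.

(** * Counting the cofactors of a fixed factor *)

Implicit Types p q : {poly 'F_2}.

Lemma F2_addrr (x : 'F_2) : x + x = 0.
Proof. exact: (addrr_pchar2 (pchar_Fp (isT : prime 2))). Qed.

Definition nz (x : 'F_2) : bool := x != 0.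

Lemma F2_nz (x : 'F_2) : x = (nz x)%:R.
Proof. by apply: val_inj; case: x => [[|[|m]] /=]. Qed.

Lemma nz_natr (b : bool) : nz b%:R = b.
Proof. by case: b. Qed.

Lemma nz_inj : injective nz.
Proof. by move=> x y e; rewrite [x]F2_nz [y]F2_nz e. Qed.

Lemma nzD x y : nz (x + y) = nz x (+) nz y.
Proof.
by rewrite [x]F2_nz [y]F2_nz; case: (nz x); case: (nz y); rewrite !nz_natr.
Qed.

Lemma nzB x y : nz (x - y) = nz x (+) nz y.
Proof.
rewrite -nzD; congr nz.
by rewrite -[RHS]subr0 -(F2_addrr y) opprD addrA addrK.
Qed.

Lemma nzM x y : nz (x * y) = nz x && nz y.
Proof. by rewrite /nz mulf_eq0 negb_or. Qed.

Definition bit (f : {poly 'F_2}) (i : nat) : bool := nz f`_i.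

Lemma bitB f g i : bit (f - g) i = bit f i (+) bit g i.
Proof. by rewrite /bit coefB nzB. Qed.

(* An integer, unlike the coefficient of f * g at i, which is its residue mod 2:
   for g = rev_poly n f this is the multiplicity of n - i in the difference
   multiset. *)
Definition corr (f g : {poly 'F_2}) (i : nat) : nat :=
  (\sum_(j < i.+1) bit f j * bit g (i - j))%N.

(** Splits off the only two terms that involve a coefficient of index [i]; the remaining sum uses
    indices strictly between 0 and [i]. *)
Lemma corr_ends f g i : (0 < i)%N -> bit f 0 -> bit g 0 ->
  corr f g i = (bit f i + bit g i +
    \sum_(j < i.-1) bit f j.+1 * bit g (i - j.+1))%N.
Proof.
case: i => // i _ f0 g0; rewrite /corr big_ord_recl big_ord_recr/= subn0.
rewrite /bump/= subnn f0 g0 mul1n muln1 addnA addnAC; congr addn.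
exact: addnC.
Qed.

(** The state of the search from both ends: the [i] lowest coefficients and those at [m], [m - 1],
    ... are fixed. *)
Definition agree m i (p p' : {poly 'F_2}) :=
  forall j, (j < i)%N -> p`_j = p'`_j /\ (rev_poly m p)`_j = (rev_poly m p')`_j.

Lemma agree_coefM m i (p p' g : {poly 'F_2}) j : agree m i p p' -> (j < i)%N ->
  (p * g)`_j = (p' * g)`_j /\
  (rev_poly m p * g)`_j = (rev_poly m p' * g)`_j.
Proof.
move=> pp' lt_j; split; apply/eqP; rewrite -subr_eq0 -coefB -mulrBl;
by rewrite (@coefM_low0 _ _ _ i 0)// ?addn0// => l lt_l;
   rewrite coefB; have [e1 e2] := pp' l lt_l; rewrite ?e1 ?e2 subrr.
Qed.

Lemma agree_coefM_top m i (p p' g : {poly 'F_2}) j :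
  (forall l, (l < j)%N -> g`_l = 0) -> bit g j -> agree m i p p' ->
  bit (p * g) (i + j) (+) bit (p' * g) (i + j) = bit p i (+) bit p' i /\
  bit (rev_poly m p * g) (i + j) (+) bit (rev_poly m p' * g) (i + j)
    = bit (rev_poly m p) i (+) bit (rev_poly m p') i.
Proof.
move=> g_low gj pp'; rewrite -!bitB -?coefB -!mulrBl /bit !coefM_low//.
- by rewrite !nzM -!/(bit _ _) gj !andbT.
- by move=> l /pp'[_ e]; rewrite coefB e subrr.
- by move=> l /pp'[e _]; rewrite coefB e subrr.
Qed.

(** Both equations give (a - b) + (c - e) the same integer value as its primed version. Priming
    negates a - b exactly when a and b differ and [x] holds, and likewise c - e with [y]. A lone
    nonzero difference therefore keeps its sign; if both are nonzero, they flip together or not at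
    all. *)
Lemma balance_cases (a b c e a' b' c' e' x y : bool) (X Y : nat) :
  a (+) a' = x -> e (+) e' = y -> b (+) b' = x -> c (+) c' = y ->
  (a' + c' + X = b' + e' + Y)%N -> (a + c + X = b + e + Y)%N ->
  [/\ a (+) b -> ~~ (e (+) c) -> ~~ x, ~~ (a (+) b) -> e (+) c -> ~~ y
    & a (+) b -> e (+) c -> x = y].
Proof.
move=> <- ey <- cy; move: ey; rewrite -cy => {x y cy}.
by case: a b c e a' b' c' e' => [] [] [] [] [] [] [] [] //= _; clear; lia.
Qed.

Section Counting.
Variables (m d k : nat) (q : {poly 'F_2}).
Let q' := rev_poly d q.
Let t := q - q'.

(* With n = m + d, A = p * q and B = p * q', the two sides are the
   multiplicities of n - i in A - A and B - B. *)
Definition homometric_factor (p : {poly 'F_2}) : bool :=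
  [&& (size p <= m.+1)%N, bit p 0, bit p m &
   [forall i : 'I_(m + d).+1, corr (p * q) (rev_poly m p * q') i
                              == corr (p * q') (rev_poly m p * q) i]].

Hypothesis q0 : bit q 0.
Hypothesis qd : bit q d.
Hypothesis t_low : forall j, (j < k)%N -> t`_j = 0.
Hypothesis t_k : bit t k.

(* The coefficients of p * t at j and at m + d - j; the latter because t is
   equal to its own reversal mod 2. *)
Let lo p j := bit (p * t) j.
Let hi p j := bit (rev_poly m p * t) j.

Let wt (x y : bool) : nat := if x || y then 2%N else 3%N.
Let w p j := wt (lo p j) (hi p j).

Let bit_q'0 : bit q' 0.
Proof. by rewrite /bit coef_rev_poly// subn0. Qed.

(** Both [q] and [q'] have constant coefficient 1, so [t] vanishes at 0. *)
Let k_gt0 : (0 < k)%N.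
Proof.
by case: k t_k => // tk; move: tk; rewrite /t bitB q0 bit_q'0.
Qed.

(** Since [t] starts at index [k], knowing [i] coefficients of [p] determines [i + k] of the
    product: a lookahead of [k]. *)
Lemma agree_lohi i p p' j : agree m i p p' -> (j < i + k)%N ->
  lo p j = lo p' j /\ hi p j = hi p' j.
Proof.
move=> pp' lt_j; rewrite /lo/hi.
by split; rewrite /bit; congr nz; apply/eqP; rewrite -subr_eq0 -coefB -mulrBl;
  rewrite (@coefM_low0 _ _ _ i k)// => l /pp'[e1 e2]; rewrite coefB ?e1 ?e2 subrr.
Qed.

Let valid p := homometric_factor p.

(* Given the coefficients of p near both ends, the equation at i only involves
   the integers A_i + A_(n-i) - B_i - B_(n-i). *)
Lemma balance_step i p p' : valid p -> valid p' -> agree m i p p' ->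
  (0 < i <= m)%N ->
  let dl := lo p (i + k) (+) lo p' (i + k) in
  let dh := hi p (i + k) (+) hi p' (i + k) in
  [/\ lo p i -> ~~ hi p i -> ~~ dl, ~~ lo p i -> hi p i -> ~~ dh
    & lo p i -> hi p i -> dl = dh].
Proof.
move=> vp vp' pp' /andP[i0 le_im] dl dh.
have [edl edh] := agree_coefM_top t_low t_k pp'.
have {}edl : dl = bit p i (+) bit p' i by [].
have {}edh : dh = bit (rev_poly m p) i (+) bit (rev_poly m p') i by [].
(* As [q] and [q'] have constant coefficient 1, passing from [p] to [p'] changes both products at
   [i] by the same bit that changes [p * t] at [i + k]. *)
have top g := @agree_coefM_top m i p p' g 0 (fun=> ltac:(by [])).
have [aq aq'] := top q q0 pp'; have [bq bq'] := top q' bit_q'0 pp'.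
rewrite !addn0 -edl -edh in aq aq' bq bq'.
have lt_i : (i < (m + d).+1)%N by rewrite ltnS (leq_trans le_im) ?leq_addr.
have ends p1 g : valid p1 -> bit g 0 -> bit (p1 * g) 0 /\ bit (rev_poly m p1 * g) 0.
  move=> /and4P[_ p10 p1m _] g0.
  by rewrite /bit !coef0M !nzM coef_rev_poly// subn0; split; apply/andP.
have eqc p1 : valid p1 -> (bit (p1 * q) i + bit (rev_poly m p1 * q') i +
    \sum_(j < i.-1) bit (p1 * q) j.+1 * bit (rev_poly m p1 * q') (i - j.+1)
   = bit (p1 * q') i + bit (rev_poly m p1 * q) i +
    \sum_(j < i.-1) bit (p1 * q') j.+1 * bit (rev_poly m p1 * q) (i - j.+1))%N.
  move=> v1; have [x0 y0] := ends _ _ v1 q0; have [z0 w0] := ends _ _ v1 bit_q'0.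
  have /and4P[_ _ _ /forallP/(_ (Ordinal lt_i))/eqP/=] := v1.
  by rewrite !corr_ends.
have := eqc _ vp; have := eqc _ vp'.
have eqs g g' : (\sum_(j < i.-1) bit (p' * g) j.+1 * bit (rev_poly m p' * g') (i - j.+1)
    = \sum_(j < i.-1) bit (p * g) j.+1 * bit (rev_poly m p * g') (i - j.+1))%N.
  apply: eq_bigr => j _; rewrite /bit.
  have lt_ji : (j.+1 < i)%N by rewrite -ltn_predRL.
  have [-> _] := agree_coefM g pp' lt_ji.
  have lt_ij : (i - j.+1 < i)%N by rewrite ltn_subrL i0.
  by have [_ ->] := agree_coefM g' pp' lt_ij.
rewrite !eqs; move: (\sum_(j < _) _)%N (\sum_(j < _) _)%N => X Y.
have -> : lo p i = bit (p * q) i (+) bit (p * q') i by rewrite -bitB -mulrBr.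
have -> : hi p i = bit (rev_poly m p * q) i (+) bit (rev_poly m p * q') i.
  by rewrite -bitB -mulrBr.
exact: balance_cases aq aq' bq bq'.
Qed.

(** As [t] has coefficient 1 at [k], the new outer pair of coefficients of [p] can be read off the
    product with [t] at [i + k]. *)
Lemma agree_next i p p' : agree m i p p' ->
  lo p (i + k) = lo p' (i + k) -> hi p (i + k) = hi p' (i + k) ->
  agree m i.+1 p p'.
Proof.
move=> pp' el eh j; rewrite ltnS leq_eqVlt => /orP[/eqP ->|]; last exact: pp'.
have [] := agree_coefM_top t_low t_k pp'.
rewrite -/(lo p _) -/(lo p' _) -/(hi p _) -/(hi p' _) el eh !addbb.
have inj x y : false = nz x (+) nz y -> x = y.
  by move=> e; apply: nz_inj; move: e; case: (nz x); case: (nz y).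
by move=> /inj e1 /inj.
Qed.

Lemma weight_step i (X : seq {poly 'F_2}) p0 :
  p0 \in X -> all valid X -> (i <= m)%N ->
  {in X &, forall p p', agree m i p p'} ->
  (\sum_(z : bool * bool)
     has (fun p => (lo p (i + k), hi p (i + k)) == z) X * wt z.1 z.2
   <= 3 * w p0 i)%N.
Proof.
move=> p0X /allP vX le_im agX.
set key := fun p => (lo p (i + k), hi p (i + k)).
(* It suffices to enclose the realised keys in a predicate: [predT] has weight 3 + 2 + 2 + 2, the
   constrained ones at most 5. *)
have pre (P : pred (bool * bool)) : (forall p, p \in X -> P (key p)) ->
    (\sum_(z : bool * bool) has (fun p => key p == z) X * wt z.1 z.2
     <= \sum_(z : bool * bool) P z * wt z.1 z.2)%N.
  move=> PX; apply: leq_sum => z _; rewrite leq_mul2r; apply/orP; right.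
  by case: hasP => // -[p pX /eqP <-]; rewrite PX.
have sumE (P : pred (bool * bool)) : (\sum_(z : bool * bool) P z * wt z.1 z.2
   = P (true, true) * 2 + P (true, false) * 2 + P (false, true) * 2
     + P (false, false) * 3)%N.
  transitivity (\sum_(z : bool * bool) P (z.1, z.2) * wt z.1 z.2)%N.
    by apply: eq_bigr => -[].
  rewrite -(pair_bigA _ (fun x y : bool => P (x, y) * wt x y)%N)/=.
  by rewrite big_bool/= !big_bool/= addnA.
(* No balance equation is available at 0, but the pair there is (0, 0) because [k] is positive, so
   all four keys are affordable. *)
have [i0|i_gt0] := posnP i.
  have -> : w p0 i = 3%N by rewrite /w i0 /lo /hi /bit !coef0M t_low// !mulr0.
  by apply: leq_trans (pre predT _) _; rewrite ?sumE.
have im : (0 < i <= m)%N by rewrite i_gt0.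
have step p : p \in X -> _ :=
  fun pX => balance_step (vX _ p0X) (vX _ pX) (agX _ _ p0X pX) im.
rewrite /w; case El: (lo p0 i); case Eh: (hi p0 i).
- apply: leq_trans (pre (fun z => z.1 (+) z.2 == (key p0).1 (+) (key p0).2) _) _.
    move=> p /step[_ _ /(_ El Eh)]; rewrite /key/=.
    by case: (lo p _); case: (lo p0 _); case: (hi p _); case: (hi p0 _).
  by rewrite sumE/=; case: (_ (+) _).
- apply: leq_trans (pre (fun z => z.1 == (key p0).1) _) _.
    move=> p /step[+ _ _] => /(_ El); rewrite Eh => /(_ isT); rewrite /key/=.
    by case: (lo p _); case: (lo p0 _).
  by rewrite sumE/=; case: (lo p0 _).
- apply: leq_trans (pre (fun z => z.2 == (key p0).2) _) _.
    move=> p /step[_ + _]; rewrite El => /(_ isT Eh); rewrite /key/=.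
    by case: (hi p _); case: (hi p0 _).
  by rewrite sumE/=; case: (hi p0 _).
- by apply: leq_trans (pre predT _) _; rewrite ?sumE.
Qed.

(* The product is the weight of the pairs (E_j, E_(n-j)) that are determined
   but not yet used. *)
Lemma count_agree r i (X : seq {poly 'F_2}) p0 :
  uniq X -> p0 \in X -> all valid X -> (i + r = m.+1./2)%N ->
  {in X &, forall p p', agree m i p p'} ->
  (size X * 2 ^ k <= 2 * 3 ^ r * \prod_(j < k) w p0 (i + j))%N.
Proof.
elim: r i X p0 => [|r IH] i X p0 uX p0X vX eq_h agX.
  have w2 : (2 ^ k <= \prod_(j < k) w p0 (i + j))%N.
    rewrite -[X in (_ ^ X)%N]card_ord -prod_nat_const; apply: leq_prod => j _.
    by rewrite /w /wt; case: ifP.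
  rewrite expn0 muln1; apply: leq_mul w2.
  (* With [i] equal to half of [m + 1] rounded down, at most the middle coefficient, at index [i],
     is still free; hence the factor 2. *)
  have injX : {in X &, injective (fun p : {poly 'F_2} => p`_i)}.
    move=> p p' pX p'X e; apply/polyP => j.
    have /and4P[sp _ _ _] := allP vX _ pX.
    have /and4P[sp' _ _ _] := allP vX _ p'X.
    have [lt_ji | le_ij] := ltnP j i; first by have [] := agX _ _ pX p'X _ lt_ji.
    have [-> //| ne_ji] := eqVneq j i.
    have [lt_mj | le_jm] := ltnP m j.
      by rewrite !nth_default// (leq_trans _ lt_mj).
    have lt_mji : (m - j < i)%N by clear -eq_h le_ij ne_ji le_jm; lia.
    have [_] := agX _ _ pX p'X _ lt_mji.
    by rewrite !coef_rev_poly ?leq_subr// subKn.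
  rewrite -(size_map (fun p : {poly 'F_2} => p`_i)).
  have /card_uniqP <- : uniq [seq (p : {poly 'F_2})`_i | p <- X].
    by rewrite map_inj_in_uniq.
  by rewrite (leq_trans (max_card _))// card_Fp.
have le_im : (i <= m)%N by clear -eq_h; lia.
set key := fun p => (lo p (i + k), hi p (i + k)).
have sizeX : size X = (\sum_(z : bool * bool) size [seq p <- X | key p == z])%N.
  rewrite -sum1_size (partition_big key predT)//=; apply: eq_bigr => z _.
  by rewrite sum1_count size_filter.
(* The part of the window common to steps [i] and [i.+1]; by the lookahead it is the same for every
   [p] in [X]. *)
set Psi := (\prod_(j < k.-1) w p0 (i + j.+1))%N.
have PhiE : (\prod_(j < k) w p0 (i + j) = w p0 i * Psi)%N.
  rewrite /Psi; move: k_gt0 (w p0) => + W.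
  by case: (k) => // l _; rewrite big_ord_recl addn0.
have PhiS p : (\prod_(j < k) w p (i.+1 + j) =
    (\prod_(j < k.-1) w p (i + j.+1)) * w p (i + k))%N.
  move: k_gt0 (w p) => + W; case: (k) => // l _.
  rewrite big_ord_recr/= addSnnS; congr muln.
  by apply: eq_bigr => j _; rewrite addSnnS.
(* Polynomials sharing a key agree one step further, so the induction hypothesis applies to each
   class; its window loses the weight at [i] and gains the weight of the key. *)
have bound z : (size [seq p <- X | key p == z] * 2 ^ k <=
    2 * 3 ^ r * Psi * (has (fun p => key p == z) X * wt z.1 z.2))%N.
  have [/hasP[p pX /eqP kp]|/negbTE nX] := boolP (has _ X); last first.
    by rewrite size_filter; move: nX; rewrite has_count lt0n => /negbFE/eqP->.
  have pXz : p \in [seq p <- X | key p == z] by rewrite mem_filter kp eqxx.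
  rewrite mul1n -mulnA; apply: leq_trans (IH i.+1 _ p (filter_uniq _ uX) pXz _ _ _) _.
  - by apply/allP => p1; rewrite mem_filter => /andP[_ /(allP vX)].
  - by rewrite addSnnS.
  - move=> p1 p2; rewrite !mem_filter => /andP[/eqP k1 p1X] /andP[/eqP k2 p2X].
    by apply: agree_next; [exact: agX | |]; move: (etrans k1 (esym k2)) => [].
  - rewrite PhiS -kp eq_leq//; congr (_ * (_ * _))%N; apply: eq_bigr => j _; rewrite /w.
    have lt_j : (i + j.+1 < i + k)%N.
      by rewrite ltn_add2l -[X in (_ < X)%N](prednK k_gt0) ltnS.
    by have [-> ->] := agree_lohi (agX _ _ pX p0X) lt_j.
rewrite sizeX big_distrl/= PhiE.
apply: (@leq_trans (\sum_(z : bool * bool)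
   2 * 3 ^ r * Psi * (has (fun p => key p == z) X * wt z.1 z.2))%N).
  by apply: leq_sum => z _; exact: bound.
rewrite -big_distrr/= [in X in (_ <= X)%N]expnS.
have := weight_step p0X vX le_im agX.
rewrite -/key => /(leq_mul (leqnn (2 * 3 ^ r * Psi)))/leq_trans; apply.
by rewrite eq_leq//; ring.
Qed.

(** Start with nothing fixed; the initial window has [k] weights, each at most 3. *)
Lemma count_homometric_factors (X : seq {poly 'F_2}) :
  uniq X -> all valid X -> (size X * 2 ^ k <= 2 * 3 ^ (m.+1./2 + k))%N.
Proof.
case: X => // p0 X uX vX.
apply: leq_trans (count_agree (i := 0) uX (mem_head _ _) vX erefl _) _.
  by move=> p p' _ _ j.
rewrite expnD mulnA leq_mul2l; apply/orP; right.
rewrite -[X in (_ <= _ ^ X)%N]card_ord -prod_nat_const; apply: leq_prod => j _.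
by rewrite /w /wt; case: ifP.
Qed.

End Counting.

(** * Factorization of homometric pairs *)

(** The coefficients from [k] to [d] determine [q]: each lower one equals its mirror image, which
    lies in that range because [k.*2 <= d]. *)
Lemma count_low_palindromic d k (U : seq {poly 'F_2}) : (k.*2 <= d)%N ->
  uniq U ->
  (forall q, q \in U -> (size q <= d.+1)%N /\
     forall j, (j < k)%N -> (q - rev_poly d q)`_j = 0) ->
  (size U <= 2 ^ (d.+1 - k))%N.
Proof.
move=> le_kd uU symU.
pose f (q : {poly 'F_2}) : 'rV['F_2]_(d.+1 - k) := \row_j q`_(k + j).
have injf : {in U &, injective f}.
  move=> q1 q2 /symU[s1 h1] /symU[s2 h2] e; apply/polyP => j.
  have high i : (k <= i)%N -> q1`_i = q2`_i.
    move=> le_ki; have [le_id|lt_di] := leqP i d; last first.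
      by rewrite !nth_default// (leq_trans _ lt_di).
    have lt_i : (i - k < d.+1 - k)%N by rewrite ltn_sub2r// ltnS; lia.
    by move/rowP/(_ (Ordinal lt_i)): e; rewrite !mxE/= subnKC.
  have [/high // | lt_jk] := leqP k j.
  have le_jd : (j <= d)%N by lia.
  move: (h1 _ lt_jk) (h2 _ lt_jk); rewrite !coefB !coef_rev_poly//.
  by move=> /subr0_eq-> /subr0_eq->; apply: high; lia.
have /card_uniqP : uniq [seq f q | q <- U] by rewrite map_inj_in_uniq.
rewrite size_map => <-; rewrite (leq_trans (max_card _))//.
by rewrite card_mx card_Fp// mul1n.
Qed.

Lemma coef_bit (f : {poly 'F_2}) i : f`_i = (bit f i)%:R.
Proof. exact: F2_nz. Qed.

Lemma coefM_corr (f g : {poly 'F_2}) i : (f * g)`_i = (corr f g i)%:R.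
Proof.
rewrite coefM natr_sum; apply: eq_bigr => j _.
by rewrite natrM !coef_bit.
Qed.

Lemma corrC f g i : corr f g i = corr g f i.
Proof.
rewrite /corr (reindex_inj rev_ord_inj)/=; apply: eq_bigr => j _.
by rewrite subSS subKn 1?mulnC// -ltnS.
Qed.

(** Reduction mod 2 gives the coefficients up to [n]; the others follow because both products are
    palindromic of nominal degree [n + n]. *)
Lemma eq_autocorr n (A B : {poly 'F_2}) :
  (size A <= n.+1)%N -> (size B <= n.+1)%N ->
  (forall i, (i <= n)%N -> corr A (rev_poly n A) i = corr B (rev_poly n B) i) ->
  A * rev_poly n A = B * rev_poly n B.
Proof.
move=> sA sB eAB.
have sym (C : {poly 'F_2}) : (size C <= n.+1)%N ->
    rev_poly (n + n) (C * rev_poly n C) = C * rev_poly n C.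
  by move=> sC; rewrite rev_polyM ?size_rev_poly// rev_polyK// mulrC.
have low i : (i <= n)%N -> (A * rev_poly n A)`_i = (B * rev_poly n B)`_i.
  by move=> le_i; rewrite !coefM_corr eAB.
apply/polyP => i; have [/low //|lt_ni] := leqP i n.
rewrite -(sym A)// -(sym B)// !coef_poly; case: ifP => // lt_i.
by apply: low; lia.
Qed.

(** Take [p] to be the gcd and [u], [v] the coprime cofactors. Cancelling [p] and its reversal
    leaves [u * rev_poly d u = v * rev_poly d v], so [u] divides the reversal of [v]; comparing
    sizes, the quotient is a constant, and it is 1 over F_2. *)
Lemma palindromic_factor n (A B : {poly 'F_2}) :
  size A = n.+1 -> size B = n.+1 -> bit A 0 -> bit B 0 ->
  A * rev_poly n A = B * rev_poly n B ->
  exists m d (p q : {poly 'F_2}), [/\ (m + d)%N = n, size p = m.+1, size q = d.+1,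
    A = p * q & B = p * rev_poly d q].
Proof.
move=> sA sB A0 B0 eAB.
have nzA : A != 0 by rewrite -size_poly_eq0 sA.
have nzB : B != 0 by rewrite -size_poly_eq0 sB.
pose g := gcdp A B; pose u := A %/ g; pose v := B %/ g.
have nzg : g != 0 by rewrite gcdp_eq0 negb_and nzA.
have Ag : A = g * u by rewrite mulrC divpK ?dvdp_gcdl.
have Bg : B = g * v by rewrite mulrC divpK ?dvdp_gcdr.
have nzu : u != 0 by apply: contraNneq nzA => u0; rewrite Ag u0 mulr0.
have nzv : v != 0 by apply: contraNneq nzB => v0; rewrite Bg v0 mulr0.
have cuv : coprimep u v by apply: coprimep_div_gcd; rewrite nzA.
pose m := (size g).-1; pose d := (size u).-1.
have sg : size g = m.+1 by rewrite prednK// size_poly_gt0.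
have su : size u = d.+1 by rewrite prednK// size_poly_gt0.
have mdn : (m + d)%N = n.
  by apply: succn_inj; rewrite -sA Ag size_mul// sg su addnS.
have sv : size v = d.+1.
  have := sB; rewrite Bg size_mul// sg -mdn.
  by rewrite addSn/= -addnS => /eqP; rewrite eqn_add2l => /eqP.
have bitM0 p1 p2 : bit (p1 * p2) 0 = bit p1 0 && bit p2 0.
  by rewrite /bit coef0M nzM.
have g0 : bit g 0 by move: A0; rewrite Ag bitM0 => /andP[].
have nzrg : rev_poly m g != 0.
  apply: contraTneq g0 => rg0; rewrite -(rev_polyK (f := g) (n := m)) ?sg// rg0.
  by rewrite /bit coef_rev_poly// coef0.
have euv : u * rev_poly d u = v * rev_poly d v.
  have := eAB; rewrite Ag Bg -mdn !rev_polyM ?sg ?su ?sv//.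
  rewrite (mulrACA g u) (mulrACA g v).
  by move/(mulfI (mulf_neq0 nzg nzrg)).
have nzrv : rev_poly d v != 0.
  apply: contraNneq nzv => rv0; rewrite -(rev_polyK (f := v) (n := d)) ?sv// rv0.
  by apply/eqP/polyP => i; rewrite coef_poly !coef0 if_same.
have /dvdpP[c ec] : u %| rev_poly d v.
  by rewrite -(Gauss_dvdpr _ cuv) -euv dvdp_mulr.
have nzc : c != 0 by apply: contraNneq nzrv => c0; rewrite ec c0 mul0r.
have : size c = 1%N.
  apply/eqP; rewrite eqn_leq size_poly_gt0 nzc andbT.
  have := size_rev_poly d v; rewrite ec size_mul// su addnS/=.
  by rewrite -(leq_add2r d (size c) 1).
move=> /eqP/size_poly1P[x nzx ex].
have x1 : x = 1 by rewrite (F2_nz x) /nz nzx.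
exists m, d, g, u; split => //.
have <- : rev_poly d v = u by rewrite ec ex x1 mul1r.
by rewrite rev_polyK ?sv.
Qed.

Lemma bit_size_ends n (p : {poly 'F_2}) : size p = n.+1 -> bit p n.
Proof.
move=> sp; rewrite /bit /nz; have := lead_coefE p; rewrite sp/= => <-.
by rewrite lead_coef_eq0 -size_poly_eq0 sp.
Qed.

Lemma bit0M (p q : {poly 'F_2}) : bit (p * q) 0 = bit p 0 && bit q 0.
Proof. by rewrite /bit coef0M nzM. Qed.

Lemma homometric_factor_intro m d (p q : {poly 'F_2}) :
  size p = m.+1 -> size q = d.+1 -> bit p 0 ->
  (forall i, (i <= m + d)%N -> corr (p * q) (rev_poly (m + d) (p * q)) i
     = corr (p * rev_poly d q) (rev_poly (m + d) (p * rev_poly d q)) i) ->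
  homometric_factor m d q p.
Proof.
move=> sp sq p0 eqc; apply/and4P; split; rewrite ?sp//.
  exact: bit_size_ends.
apply/forallP => -[i lt_i]; apply/eqP => /=; have := eqc i.
by rewrite !rev_polyM ?sp ?sq ?size_rev_poly// rev_polyK ?sq//; apply.
Qed.

(** Take the lowest nonzero index [k] of the difference. Mod 2 the difference is its own reversal,
    so it is also nonzero at [d - k], and minimality gives [k <= d - k]. *)
Lemma exists_valuation d (q : {poly 'F_2}) : (size q <= d.+1)%N ->
  q != rev_poly d q ->
  exists k, [/\ (k.*2 <= d)%N, bit (q - rev_poly d q) k &
    forall j, (j < k)%N -> (q - rev_poly d q)`_j = 0].
Proof.
move=> sq neq; set t := q - _.
have nzt : t != 0 by rewrite subr_eq0.
have ext : exists k, bit t k.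
  by exists (size t).-1; apply: bit_size_ends; rewrite prednK// size_poly_gt0.
case: (ex_minnP ext) => k tk min_k; exists k; split => //; last first.
  move=> j lt_jk; apply/eqP; apply: contraTT lt_jk => tj; rewrite -leqNgt.
  exact: min_k.
have st : (size t <= d.+1)%N.
  by rewrite (leq_trans (size_polyD _ _))// geq_max sq size_polyN size_rev_poly.
have le_kd : (k <= d)%N.
  rewrite -ltnS; apply: contraTT tk; rewrite -leqNgt => le_dk.
  by rewrite /bit nth_default// (leq_trans st).
have : bit t (d - k).
  have := tk; rewrite /t !bitB /bit !coef_rev_poly ?leq_subr// subKn//.
  by rewrite addbC.
by move/min_k; lia.
Qed.

Definition asym_factored n (A : {poly 'F_2}) : Prop :=
  exists d k (p q : {poly 'F_2}), [/\ (d.*2 <= n)%N,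
    [/\ (k.*2 <= d)%N, bit (q - rev_poly d q) k &
        forall j, (j < k)%N -> (q - rev_poly d q)`_j = 0],
    [/\ (size q <= d.+1)%N, bit q 0 & bit q d],
    homometric_factor (n - d) d q p & A = p * q].

Lemma homometric_factorization n (A B : {poly 'F_2}) :
  size A = n.+1 -> size B = n.+1 -> bit A 0 -> bit B 0 ->
  (forall i, (i <= n)%N -> corr A (rev_poly n A) i = corr B (rev_poly n B) i) ->
  B != A -> B != rev_poly n A -> asym_factored n A.
Proof.
move=> sA sB A0 B0 eqc neA neA'.
have eAB : A * rev_poly n A = B * rev_poly n B.
  by apply: eq_autocorr; rewrite ?sA ?sB.
have [m [d [p [q [mdn sp sq Apq Bpq]]]]] := palindromic_factor sA sB A0 B0 eAB.
have /andP[p0 q0] : bit p 0 && bit q 0 by rewrite -bit0M -Apq.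
have [le_d | lt_d] := leqP d.*2 n.
  have [|k hk] := exists_valuation (q := q) (d := d) (eq_leq sq).
    by apply: contraNneq neA => e; rewrite Bpq -e -Apq.
  exists d, k, p, q; split => //; first by split; rewrite ?sq// bit_size_ends.
  rewrite (_ : (n - d)%N = m); last by rewrite -mdn addnK.
  by apply: homometric_factor_intro => // i le_i; rewrite -Apq -Bpq mdn eqc// -mdn.
(* Here [q] is the longer factor. The partner [rev_poly n B = q * rev_poly m p] exchanges the two
   roles. *)
have [|k hk] := exists_valuation (q := p) (d := m) (eq_leq sp).
  apply: contraNneq neA' => e.
  by rewrite Apq Bpq -mdn rev_polyM ?sp ?sq// -e.
exists m, k, q, p; split => //; last by rewrite mulrC.
- by clear -lt_d mdn; lia.
- by split; rewrite ?sp// bit_size_ends.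
rewrite (_ : (n - m)%N = d); last by rewrite -mdn addKn.
have dmn : (d + m)%N = n by rewrite addnC.
apply: homometric_factor_intro => // i le_i.
have eB : rev_poly n B = q * rev_poly m p.
  by rewrite Bpq -mdn rev_polyM ?sp ?sq ?size_rev_poly// rev_polyK ?sq// mulrC.
rewrite mulrC -Apq dmn eqc -?dmn// dmn -eB rev_polyK ?sB//.
exact: corrC.
Qed.

(** * Summation over the factors *)

Definition polys n : seq {poly 'F_2} := [seq rVpoly v | v : 'rV['F_2]_n].

Lemma polys_uniq n : uniq (polys n).
Proof. by rewrite map_inj_uniq ?enum_uniq//; exact: can_inj (@rVpolyK _ _). Qed.

Lemma mem_polys n p : (size p <= n)%N -> p \in polys n.
Proof. by move=> sp; apply/imageP; exists (poly_rV p); rewrite ?poly_rV_K. Qed.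

Lemma size_polys n p : p \in polys n -> (size p <= n)%N.
Proof. by move=> /imageP[v _ ->]; exact: size_poly. Qed.

Lemma size_flatten_map (I T : Type) (F : I -> seq T) (s : seq I) :
  size (flatten (map F s)) = (\sum_(i <- s) size (F i))%N.
Proof. by rewrite size_flatten sumnE /shape -map_comp big_map. Qed.

Section Products.
Variable n : nat.

Definition asym_factors d k : seq {poly 'F_2} :=
  [seq q <- polys d.+1 | [&& bit q 0, bit q d, bit (q - rev_poly d q) k
     & [forall j : 'I_k, (q - rev_poly d q)`_j == 0]]].

Definition cofactors d q : seq {poly 'F_2} :=
  [seq p <- polys (n - d).+1 | homometric_factor (n - d) d q p].

(** One entry per factorization, with possible repetitions: its size only bounds the number of
    products. *)
Definition homometric_products d k : seq {poly 'F_2} :=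
  flatten [seq [seq p * q | p <- cofactors d q] | q <- asym_factors d k].

Lemma asym_factorsP d k q : q \in asym_factors d k ->
  [/\ (size q <= d.+1)%N, bit q 0, bit q d, bit (q - rev_poly d q) k &
      forall j, (j < k)%N -> (q - rev_poly d q)`_j = 0].
Proof.
rewrite mem_filter => /andP[/and4P[q0 qd tk /forallP low] /size_polys sq].
split => // j lt_j; exact/eqP/(low (Ordinal lt_j)).
Qed.

(** Near-palindromicity of [q] saves one factor 2^k and the cofactor count costs (3/2)^k; the net
    decay (3/4)^k is stated without division. *)
Lemma size_homometric_products d k : (k.*2 <= d)%N ->
  (size (homometric_products d k) * 4 ^ k
    <= 4 * (2 ^ d * 3 ^ ((n - d).+1)./2) * 3 ^ k)%N.
Proof.
move=> le_kd; rewrite size_flatten_map (eq_bigr _ (fun _ _ => size_map _ _)).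
set h := ((n - d).+1)./2.
have szU : (size (asym_factors d k) <= 2 ^ (d.+1 - k))%N.
  apply: (count_low_palindromic le_kd); first exact/filter_uniq/polys_uniq.
  by move=> q /asym_factorsP[? _ _ _ ?].
have : ((\sum_(q <- asym_factors d k) size (cofactors d q)) * 2 ^ k
    <= 2 ^ (d.+1 - k) * (2 * 3 ^ (h + k)))%N.
  rewrite big_distrl/=.
  apply: (@leq_trans (\sum_(q <- asym_factors d k) 2 * 3 ^ (h + k))%N); last first.
    by rewrite big_const_seq count_predT iter_addn_0 mulnC leq_mul2r szU orbT.
  rewrite big_seq [leqRHS]big_seq; apply: leq_sum => q.
  move=> /asym_factorsP[sq q0 qd tk low].
  apply: (count_homometric_factors q0 qd low tk).
    exact/filter_uniq/polys_uniq.
  exact: filter_all.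
move=> /(leq_mul (leqnn (2 ^ k)))/leq_trans-/(_ (4 * (2 ^ d * 3 ^ h) * 3 ^ k)%N).
move=> H; apply: leq_trans (H _); first by rewrite eq_leq// (expnMn 2 2); ring.
rewrite mulnA -expnD subnKC; last by lia.
by rewrite eq_leq// expnS expnD; ring.
Qed.

Lemma size_homometric (X : seq {poly 'F_2}) : uniq X ->
  (forall A, A \in X -> asym_factored n A) ->
  (size X <= \sum_(d < n./2.+1) \sum_(k < d./2.+1)
               size (homometric_products d k))%N.
Proof.
move=> uX facX.
pose L := flatten [seq flatten [seq homometric_products d k | k <- iota 0 d./2.+1]
                  | d <- iota 0 n./2.+1].
have -> : (\sum_(d < n./2.+1) \sum_(k < d./2.+1)
    size (homometric_products d k) = size L)%N.
  rewrite size_flatten_map -(big_mkord xpredT (fun d => \sum_(k < d./2.+1)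
    size (homometric_products d k))%N) /index_iota subn0; apply: eq_bigr => d _.
  rewrite size_flatten_map.
  by rewrite -(big_mkord xpredT (fun k => size (homometric_products d k)))
    /index_iota subn0.
apply: (uniq_leq_size uX) => A.
move=> /facX[d [k [p [q [le_d [le_k tk low] [sq q0 qd] hp ->]]]]].
apply/flattenP; exists (flatten [seq homometric_products d k | k <- iota 0 d./2.+1]).
  by apply/mapP; exists d; rewrite // mem_iota/= ltnS; clear -le_d; lia.
apply/flattenP; exists (homometric_products d k).
  by apply/mapP; exists k; rewrite // mem_iota/= ltnS; clear -le_k; lia.
apply/flattenP; exists [seq p * q | p <- cofactors d q].
  apply/mapP; exists q => //; rewrite mem_filter mem_polys// andbT q0 qd tk/=.
  by apply/forallP => j; rewrite low.
apply/mapP; exists p => //; rewrite mem_filter hp mem_polys//.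
by have /and4P[] := hp.
Qed.

End Products.

Lemma geometric_le (R : realFieldType) (x : R) n : 0 <= x < 1 ->
  \sum_(i < n) x ^+ i <= (1 - x)^-1.
Proof.
move=> /andP[x0 x1]; have px : 0 < 1 - x by rewrite subr_gt0.
rewrite -(ler_pM2l px) mulfV ?gt_eqF// -opprB mulNr -subrX1 opprB.
by rewrite gerBl exprn_ge0.
Qed.

Lemma sum_homometric_le (R : realFieldType) n (z : R) : 0 < z -> z ^+ 4 = 12 ->
  (\sum_(d < n./2.+1) \sum_(k < d./2.+1) size (homometric_products n d k))%:R
   <= 16 * (z ^+ 2 / 2) * (1 - z / 2)^-1 * z ^+ n.
Proof.
(* Here [s] is the square root of 3, and [rho < 1] because 12 < 16. From [s = z * rho] and
   [z = 2 * rho], 2^d s^(n-d) equals z^n rho^(n-2d), so the sum over [d] is geometric. *)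
move=> z0 z4; set s := z ^+ 2 / 2; set rho := z / 2.
have rho01 : 0 <= rho < 1.
  rewrite divr_ge0 ?(ltW z0)//= ltr_pdivrMr// mul1r.
  rewrite -(ltr_pXn2r (n := 4))// ?nnegrE ?ler0n ?(ltW z0)// z4.
  by rewrite -natrX ltr_nat.
have s2 : s ^+ 2 = 3 by rewrite /s; field: z4.
have s1 : 1 <= s.
  rewrite -(ler_pXn2r (n := 2))// ?nnegrE ?divr_ge0 ?exprn_ge0 ?(ltW z0)//.
  by rewrite s2 expr1n ler1n.
have sE : s = z * rho by rewrite /s /rho; ring.
have zE : z = 2 * rho by rewrite /rho; field.
(* Rounding [(n - d).+1] halves down costs at most one factor [s]; the exponent n - 2d is weakened
   to [n./2 - d] to fit a geometric sum. *)
have term d : (d.*2 <= n)%N ->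
    2 ^+ d * 3 ^+ ((n - d).+1)./2 <= s * z ^+ n * rho ^+ (n./2 - d).
  move=> le_d; rewrite -s2 -exprM.
  apply: (@le_trans _ _ (2 ^+ d * s ^+ (n - d).+1)).
    rewrite ler_wpM2l ?exprn_ge0//; apply: ler_weXn2l => //; clear; lia.
  have -> : 2 ^+ d * s ^+ (n - d).+1 = s * z ^+ n * rho ^+ (n - d.*2).
    have zd : z ^+ d = 2 ^+ d * rho ^+ d by rewrite -exprMn -zE.
    have [e ->] : exists e, n = (d + d + e)%N.
      by exists (n - d.*2)%N; rewrite addnn subnKC.
    rewrite -(addnA d) addKn -addnn addnA addKn exprS {2}sE exprMn !exprD zd.
    ring.
  rewrite ler_wpM2l//; last by apply: ler_wiXn2l; [lra|lra|clear -le_d; lia].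
  by rewrite mulr_ge0 ?exprn_ge0//; lra.
(* The 16 is the 4 from the size bound times the geometric sum of ratio 3/4. *)
have inner d : (d.*2 <= n)%N -> (\sum_(k < d./2.+1)
    (size (homometric_products n d k))%:R : R)
    <= 16 * (s * z ^+ n * rho ^+ (n./2 - d)).
  move=> le_d; set T := s * _ * _; have T0 : 0 <= T.
    by rewrite !mulr_ge0 ?exprn_ge0//; lra.
  apply: (@le_trans _ _ (\sum_(k < d./2.+1) 4 * T * (3 / 4) ^+ k)).
    apply: ler_sum => k _; rewrite expr_div_n mulrA ler_pdivlMr ?exprn_gt0//.
    have le_k : (k.*2 <= d)%N by have := ltn_ord k; clear; lia.
    have := size_homometric_products n le_k.
    rewrite -(ler_nat R) !natrM !natrX => /le_trans; apply.
    by rewrite ler_wpM2r ?exprn_ge0// ler_wpM2l// term.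
  rewrite -mulr_sumr (_ : 16 * T = 4 * T * 4); last by ring.
  have T4 : 0 <= 4 * T by rewrite mulr_ge0.
  rewrite ler_wpM2l// [leRHS](_ : 4 = (1 - 3 / 4)^-1); last by field.
  by apply: geometric_le; apply/andP; split; lra.
rewrite natr_sum; apply: (@le_trans _ _
    (\sum_(d < n./2.+1) 16 * (s * z ^+ n * rho ^+ (n./2 - d)))).
  apply: ler_sum => d _; rewrite natr_sum; apply: inner.
  by have := ltn_ord d; clear; lia.
have szn0 : 0 <= s * z ^+ n by rewrite mulr_ge0 ?exprn_ge0//; lra.
rewrite -!mulr_sumr [leRHS](_ : _ = 16 * (s * z ^+ n * (1 - rho)^-1)).
  rewrite ler_wpM2l// ler_wpM2l//; rewrite (reindex_inj rev_ord_inj)/=.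
  under eq_bigr => d _ do rewrite subSS subKn -1?ltnS//.
  exact: geometric_le.
by rewrite mulrAC !mulrA.
Qed.

(** * Difference multisets *)

Section InvolutionFibres.
Local Open Scope fset_scope.
Local Open Scope nat_scope.
Variables (T U : choiceType) (S : {fset T}) (f : T -> U) (sigma : T -> T).
Hypothesis sigmaS : {in S, forall x, sigma x \in S}.
Hypothesis f_sigma : {in S, forall x, f (sigma x) = f x}.

Definition exceptional (x : T) : bool :=
  has (fun x' => [&& f x' == f x, x' != x & x' != sigma x]) S.

Let sum_fibres (F : T -> nat) :
  \sum_(x <- S) F x =
  \sum_(y <- [fset f x | x in S]) \sum_(x <- [seq x <- S | f x == y]) F x.
Proof.
rewrite (partition_big_imfset _ f); apply: eq_bigr => y _.
by rewrite big_filter.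
Qed.

(** A fibre of exceptional points is paid for by the count; any other has a point [x] for which it
    lies in {x, sigma x}. *)
Lemma card_le_fibres :
  #|` S| <= 2 * #|` [fset f x | x in S]| + count exceptional S.
Proof.
rewrite -sum1_size -sum1_count big_mkcond [X in _ + X]big_mkcond/= !sum_fibres.
rewrite -[X in 2 * X]sum1_size big_distrr -big_split/=.
apply: leq_sum => y _; set s := [seq x <- S | _]; rewrite muln1.
have us : uniq s by rewrite filter_uniq// fset_uniq.
have [/allP all_s|] := boolP (all exceptional s).
  apply: leq_trans (leq_addl _ _); rewrite big_seq [X in _ <= X]big_seq.
  by apply: leq_sum => x /all_s ->.
move=> /allPn[x xs nx]; apply: leq_trans (leq_addr _ _).
rewrite sum1_size; apply: (uniq_leq_size (s2 := [:: x; sigma x]) us) => x' x's.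
rewrite !inE; apply: contraNT nx; rewrite negb_or => /andP[n1 n2].
move: xs x's; rewrite !mem_filter => /andP[/eqP fx _] /andP[/eqP fx' x'S].
by apply/hasP; exists x'; rewrite // fx fx' eqxx n1 n2.
Qed.

(** Each fibre contains some [x] and [sigma x]: either two distinct points, or a fixed point, which
    is counted a second time. *)
Lemma fibres_le_card :
  2 * #|` [fset f x | x in S]| <= #|` S| + count (fun x => sigma x == x) S.
Proof.
rewrite -sum1_size -sum1_count big_mkcond -[X in _ <= X + _]sum1_size.
rewrite [X in _ <= X + _]big_mkcond [X in _ + X]big_mkcond/= !sum_fibres.
rewrite big_distrr -big_split/= big_seq [X in _ <= X]big_seq.
apply: leq_sum => y /imfsetP[x /= xS ->]; rewrite muln1.
set s := [seq _ <- S | _].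
have us : uniq s by rewrite filter_uniq// fset_uniq.
have xs : x \in s by rewrite mem_filter eqxx.
have sxs : sigma x \in s by rewrite mem_filter f_sigma// eqxx sigmaS.
rewrite sum1_size; have [e|ne] := eqVneq (sigma x) x.
  rewrite (@leq_add 1 1)//; first by case: (s) xs.
  by rewrite (big_rem x)//= e eqxx.
apply: leq_trans (leq_addr _ _).
apply: (@uniq_leq_size _ [:: x; sigma x]); first by rewrite /= inE eq_sym ne.
by move=> x'; rewrite !inE => /orP[]/eqP->.
Qed.
End InvolutionFibres.

Lemma diff_msetE (A : {fset int}) (d : int) :
  diff_mset A d = (\sum_(a <- A) \sum_(b <- A) (a - b == d)%R)%N.
Proof.
rewrite /diff_mset mset_seqE -sum1_count big_mkcond/= big_allpairs_dep/=.
by apply: eq_bigr => a _; apply: eq_bigr => b _; rewrite /=; case: eqP.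
Qed.

Lemma diff_mset_memE (A : {fset int}) (d : int) :
  diff_mset A d = (\sum_(b <- A) ((b + d)%R \in A))%N.
Proof.
rewrite diff_msetE exchange_big; apply: eq_bigr => b _ /=.
under eq_bigr => a _ do rewrite subr_eq addrC.
rewrite -(count_uniq_mem _ (fset_uniq A)) -sum1_count [RHS]big_mkcond/=.
by apply: eq_bigr => a _; case: eqP.
Qed.

Lemma sum_fset_upto n (A : {fset int}) (F : int -> nat) :
  (A `<=` int_upto n)%fset ->
  (\sum_(a <- A) F a = \sum_(j < n.+1) (j%:Z \in A) * F j%:Z)%N.
Proof.
move=> sA.
have pA : perm_eq A [seq a <- [seq j%:Z | j <- iota 0 n.+1] | a \in A].
  apply: uniq_perm; rewrite ?fset_uniq ?filter_uniq//.
    by rewrite map_inj_uniq ?iota_uniq// => i j [].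
  move=> a; rewrite mem_filter; case: (boolP (a \in A)) => //= aA.
  have /imfsetP[i /= i_in ->] := fsubsetP sA _ aA.
  by rewrite -[_ :: _]/(map Posz (iota 0 n.+1)) map_f.
rewrite (perm_big _ pA) big_filter big_map -[iota _ _]/(index_iota 0 n.+1).
rewrite big_mkord big_mkcond/=; apply: eq_bigr => j _.
by case: (_ \in _); rewrite ?mul1n.
Qed.

Lemma end_subsetsP n (A : {fset int}) :
  reflect [/\ (A `<=` int_upto n)%fset, 0 \in A & n%:Z \in A]
          (A \in end_subsets n).
Proof.
rewrite !inE/= fpowersetE.
by apply: (iffP and3P) => -[].
Qed.

Lemma mem_int_upto n (a : int) :
  reflect (exists2 i, (i <= n)%N & a = i%:Z) (a \in int_upto n).
Proof.
apply: (iffP idP) => [/imfsetP[i /=]|[i le_in ->]].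
  by rewrite -[_ \in _]/(i \in iota 0 n.+1) mem_iota => ? ->; exists i.
by apply/imfsetP; exists i; rewrite //= -[_ \in _]/(i \in iota 0 n.+1) mem_iota.
Qed.

(** * Subsets of 0..n as polynomials, and their reflections *)

Definition indicator_poly n (A : {fset int}) : {poly 'F_2} :=
  \poly_(i < n.+1) (i%:Z \in A)%:R.

Lemma bit_indicator n A i : (A `<=` int_upto n)%fset ->
  bit (indicator_poly n A) i = (i%:Z \in A).
Proof.
move=> sA; rewrite /bit coef_poly ltnS; case: ifP => [_|/negbT le_in].
  exact: nz_natr.
rewrite /nz eqxx/=; apply/esym/negbTE; apply: contra le_in => /(fsubsetP sA).
by case/mem_int_upto => j le_j [->].
Qed.

Lemma size_indicator n A : n%:Z \in A -> size (indicator_poly n A) = n.+1.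
Proof. by move=> nA; rewrite size_poly_eq// nA oner_eq0. Qed.

Lemma indicator_inj n :
  {in [pred A | (A `<=` int_upto n)%fset] &, injective (indicator_poly n)}.
Proof.
move=> A B /= sA sB e; apply/fsetP => a.
apply/idP/idP => aIn; have /mem_int_upto[i _ ea] :
    a \in int_upto n by [apply: (fsubsetP sA)|apply: (fsubsetP sB)].
  by rewrite ea -(bit_indicator _ sB) -e bit_indicator// -ea.
by rewrite ea -(bit_indicator _ sA) e bit_indicator// -ea.
Qed.

Lemma corr_indicator n (A : {fset int}) i : (A `<=` int_upto n)%fset ->
  (i <= n)%N ->
  corr (indicator_poly n A) (rev_poly n (indicator_poly n A)) i
  = diff_mset A (n - i)%:Z.
Proof.
move=> sA le_in; rewrite diff_mset_memE (sum_fset_upto _ sA) /corr.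
rewrite (big_ord_widen n.+1 (fun j => bit (indicator_poly n A) j *
  bit (rev_poly n (indicator_poly n A)) (i - j))%N)// big_mkcond/=.
apply: eq_bigr => j _; rewrite bit_indicator// -PoszD ltnS.
case: (leqP j i) => [le_ji | lt_ij].
  congr (_ * nat_of_bool _)%N; rewrite /bit coef_rev_poly -/(bit _ _).
    by rewrite bit_indicator//; congr (Posz _ \in A); clear -le_in le_ji; lia.
  by rewrite (leq_trans (leq_subr _ _)).
(* For [j] above [i], the element j + (n - i) exceeds [n] and cannot lie in [A]. *)
rewrite [X in (_ * X)%N](_ : _ = 0%N) ?muln0//; apply/eqP; rewrite eqb0.
apply/negP => /(fsubsetP sA)/mem_int_upto[l le_ln [el]].
by move: el le_ln lt_ij le_in; clear; lia.
Qed.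

Definition reflect_fset n (A : {fset int}) : {fset int} :=
  [fset n%:Z - a | a in A]%fset.

Lemma mem_reflect_fset n A a : (a \in reflect_fset n A) = (n%:Z - a \in A).
Proof.
apply/imfsetP/idP => /= [[b bA ->]|naA]; first by rewrite subKr.
by exists (n%:Z - a); rewrite ?subKr.
Qed.

Lemma reflect_fset_end n A : A \in end_subsets n ->
  reflect_fset n A \in end_subsets n.
Proof.
move=> /end_subsetsP[sA A0 An]; apply/end_subsetsP.
rewrite !mem_reflect_fset subr0 subrr; split => //.
apply/fsubsetP => a; rewrite mem_reflect_fset => /(fsubsetP sA)/mem_int_upto.
move=> [i le_in ea]; apply/mem_int_upto; exists (n - i)%N; first exact: leq_subr.
by rewrite -subzn// -ea subKr.
Qed.

Lemma diff_mset_reflect n A : diff_mset (reflect_fset n A) = diff_mset A.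
Proof.
apply/msetP => d; rewrite !diff_msetE.
have inj : injective (fun a : int => n%:Z - a).
  by move=> a b /addrI/oppr_inj.
rewrite big_imfset/=; last by move=> a b _ _; exact: inj.
rewrite exchange_big big_imfset/=; last by move=> a b _ _; exact: inj.
apply: eq_bigr => a _; apply: eq_bigr => b _.
by congr (nat_of_bool (_ == _)); ring.
Qed.

Lemma indicator_reflect n A : (A `<=` int_upto n)%fset ->
  indicator_poly n (reflect_fset n A) = rev_poly n (indicator_poly n A).
Proof.
move=> sA; apply/polyP => i; rewrite !coef_poly ltnS; case: ifP => // le_in.
by rewrite ltnS leq_subr mem_reflect_fset subzn.
Qed.

Lemma card_int_upto n : #|` int_upto n| = n.+1.
Proof.
rewrite -[RHS](size_iota 0) -(size_map Posz); apply/perm_size/uniq_perm.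
- exact: fset_uniq.
- by rewrite map_inj_uniq ?iota_uniq// => i j [].
by move=> a; apply/imfsetP/mapP.
Qed.

(** Adjoining the distinct points 0 and [n] is a bijection from the subsets of the [n.-1] interior
    points. *)
Lemma card_end_subsets n : (1 <= n)%N -> #|` end_subsets n| = (2 ^ n.-1)%N.
Proof.
move=> n1; pose I := (int_upto n `\ 0%R `\ n%:Z)%fset.
have up0 : 0%:Z \in int_upto n by apply/mem_int_upto; exists 0%N.
have upn : n%:Z \in int_upto n by apply/mem_int_upto; exists n.
have n0 : n%:Z != 0 by rewrite eqz_nat -lt0n.
have cI : #|` I| = n.-1.
  have c0 := cardfsD1 0%:Z (int_upto n).
  have cn := cardfsD1 n%:Z (int_upto n `\ 0%:Z)%fset.
  rewrite card_int_upto up0 cn in_fsetD1 n0 upn !add1n in c0.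
  by case: c0 => ->.
rewrite -cI -card_fpowerset.
have -> : end_subsets n = [fset (0%R |` (n%:Z |` B))%fset | B in fpowerset I]%fset.
  apply/fsetP => A; apply/end_subsetsP/imfsetP => /= [[sA A0 An]|[B]].
    exists (A `\ 0%R `\ n%:Z)%fset.
      by rewrite fpowersetE /I !fsetSD.
    apply/fsetP => a; rewrite !inE.
    have [->|_] := eqVneq a 0; first by rewrite A0.
    by have [->|_] := eqVneq a n%:Z; first by rewrite An.
  rewrite fpowersetE => /fsubsetP sB ->; rewrite !inE !eqxx orbT; split => //.
  apply/fsubsetP => a; rewrite !inE => /or3P[/eqP->|/eqP->|/sB] //.
  by rewrite !inE => /and3P[].
rewrite card_in_imfset//= => B C; rewrite !fpowersetE => /fsubsetP sB /fsubsetP sC.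
move=> /fsetP e; apply/fsetP => a; have := e a; rewrite !inE.
have notI : (a == 0) || (a == n%:Z) -> a \notin I.
  by rewrite !inE; case: eqP => //; case: eqP.
rewrite !orbA; case: (boolP ((a == 0) || (a == n%:Z))) => [/notI aI _|_ //].
by rewrite (negbTE (contra (sB a) aI)) (negbTE (contra (sC a) aI)).
Qed.

(** A set fixed by reflection is determined by its trace on 0..n/2. *)
Lemma count_reflect_fixed n :
  (count (fun A => reflect_fset n A == A) (end_subsets n) <= 2 ^ (n./2).+1)%N.
Proof.
rewrite -(card_int_upto n./2) -card_fpowerset -size_filter.
set s := [seq _ <- _ | _].
have us : uniq s by rewrite filter_uniq// fset_uniq.
pose h (A : {fset int}) := (A `&` int_upto n./2)%fset.
have injh : {in s &, injective h}.
  move=> A B; rewrite !mem_filter => /andP[/eqP fA /end_subsetsP[sA _ _]].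
  move=> /andP[/eqP fB /end_subsetsP[sB _ _]] /fsetP e.
  have low i : (i <= n./2)%N -> (i%:Z \in A) = (i%:Z \in B).
    move=> le_i; have := e i%:Z; rewrite !in_fsetI.
    have -> : i%:Z \in int_upto n./2 by apply/mem_int_upto; exists i.
    by rewrite !andbT.
  have all_i i : (i <= n)%N -> (i%:Z \in A) = (i%:Z \in B).
    move=> le_in; have [/low //|lt_i] := leqP i n./2.
    rewrite -fA -fB !mem_reflect_fset subzn//; apply: low.
    by clear -lt_i le_in; lia.
  apply/fsetP => a.
  have [/mem_int_upto[i /all_i ei ->]//|na] := boolP (a \in int_upto n).
  rewrite (negbTE (contra (fsubsetP sA a) na)).
  by rewrite (negbTE (contra (fsubsetP sB a) na)).
rewrite -(size_map h); apply: uniq_leq_size; first by rewrite map_inj_in_uniq.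
by move=> _ /mapP[A _ ->]; rewrite fpowersetE fsubsetIr.
Qed.

Lemma count_exceptional_end_subsets n :
  (count (exceptional (end_subsets n) diff_mset (reflect_fset n)) (end_subsets n)
   <= \sum_(d < n./2.+1) \sum_(k < d./2.+1) size (homometric_products n d k))%N.
Proof.
rewrite -size_filter -(size_map (indicator_poly n)); apply: size_homometric.
  rewrite map_inj_in_uniq ?filter_uniq ?fset_uniq// => A B.
  rewrite !mem_filter => /andP[_ /end_subsetsP[sA _ _]] /andP[_ /end_subsetsP[sB _ _]].
  exact: indicator_inj.
move=> _ /mapP[A + ->]; rewrite mem_filter => /andP[/hasP[B BS]].
move=> /and3P[/eqP eAB neA neA'] /end_subsetsP[sA A0 An].
have /end_subsetsP[sB B0 Bn] := BS.
have [sAi sBi] := (size_indicator An, size_indicator Bn).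
apply: (@homometric_factorization n _ (indicator_poly n B)) => //.
- by rewrite bit_indicator.
- by rewrite bit_indicator.
- by move=> i le_in; rewrite !corr_indicator// eAB.
- by apply: contra_neq neA => /indicator_inj; apply.
- rewrite -indicator_reflect//; apply: contra_neq neA' => /indicator_inj; apply=> //.
  rewrite inE; have /reflect_fset_end : A \in end_subsets n by apply/end_subsetsP.
  by case/end_subsetsP.
Qed.

Theorem corollary2p2 (R : realType) :
  exists C : R, forall n : nat, (1 <= n)%N ->
    `| (num_diff_msets n)%:R - (2%:R : R) ^ (n%:Z - 2%:Z) |
      <= C * (12%:R : R) `^ (n%:R / 4%:R).
Proof.
pose z : R := 12 `^ (1 / 4).
have z0 : 0 < z by rewrite powR_gt0.
have zX n : (12%:R : R) `^ (n%:R / 4%:R) = z ^+ n.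
  by rewrite -powR_mulrn ?ltW// -powRrM div1r mulrC.
have z4 : z ^+ 4 = 12 by rewrite -zX mulfV ?powRr1 ?pnatr_eq0.
have zz : 2 <= z ^+ 2.
  rewrite -(ler_pXn2r (n := 2))// ?nnegrE ?exprn_ge0 ?(ltW z0)// -exprM z4.
  by rewrite -natrX ler_nat.
have z1 : 1 <= z.
  by rewrite -(ler_pXn2r (n := 4))// ?nnegrE ?(ltW z0)// z4 expr1n ler1n.
pose K : R := 16 * (z ^+ 2 / 2) * (1 - z / 2)^-1.
(* [K] accounts for the exceptional sets, in the lower bound, and 2 for the reflection-fixed sets,
   in the upper bound. *)
exists (K + 2) => n n1; rewrite zX.
have low := card_le_fibres (end_subsets n) diff_mset (reflect_fset n).
have up := fibres_le_card (@reflect_fset_end n) (fun A _ => diff_mset_reflect n A).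
rewrite -/(num_diff_msets n) card_end_subsets// in low up.
have bad := le_trans (_ : _ <= _ :> R) (sum_homometric_le n z0 z4).
move: bad (count_exceptional_end_subsets n) => /[swap].
rewrite -(ler_nat R) => bad /(_ _ bad); rewrite -/K => {}bad.
have sym : (count (fun A => reflect_fset n A == A) (end_subsets n))%:R <= 2 * z ^+ n.
  apply: (@le_trans _ _ (2 ^+ (n./2).+1)).
    by rewrite -natrX ler_nat count_reflect_fixed.
  rewrite exprS ler_wpM2l// (@le_trans _ _ ((z ^+ 2) ^+ n./2))//.
    by apply: lerXn2r; rewrite ?nnegrE ?exprn_ge0 ?(ltW z0).
  by rewrite -exprM ler_weXn2l// mul2n -[leqRHS]odd_double_half leq_addl.
(* The exponent is an integer, since it is -1 for [n = 1]; one half is split off before using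
   natural powers. *)
have -> : (2%:R : R) ^ (n%:Z - 2%:Z) = (2 ^ n.-1)%:R / 2.
  case: n n1 {low up bad sym} => // m _ /=.
  rewrite (_ : m.+1%:Z - 2%:Z = m%:Z + -1); last by lia.
  by rewrite expfzDr ?pnatr_eq0// natrX exprN1.
move: low up; rewrite -!(ler_nat R) !natrD => low up.
rewrite ler_norml mulrDl; have up' := le_trans up (lerD (lexx _) sym).
have low' := le_trans low (lerD (lexx _) bad).
have K0 : 0 <= K * z ^+ n by apply: le_trans bad.
have Z0 : 0 <= z ^+ n by rewrite exprn_ge0// ltW.
by apply/andP; split; lra.
Qed.
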